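(* Let $\mathbb{K}$ be a commutative field, $U$ and $V$ be $\mathbb{K}$-vector spaces (possibly infinite-dimensional), and $\mathcal{S}$ be an $n$-dimensional LLD linear subspace of $\mathcal{L}(U,V)$. Assume that $\#\mathbb{K}\geq n$ and that $\mathcal{S}$ is not $2$-LLD. Then: (i) either $\operatorname{rk} f\leq n-1$ for every $f\in\mathcal{S}$; (ii) or, for every rank-optimal operator $\varphi\in\widehat{\mathcal{S}}$ and every $f\in\operatorname{Ker}\varphi$, one has $\operatorname{rk} f<n-1$.
   Context: $\mathcal{L}(U,V)$ is the space of all linear operators from $U$ to $V$. For a positive integer $c$, a finite-dimensional linear subspace $\mathcal{S}$ of $\mathcal{L}(U,V)$ is $c$-LLD ($c$-locally linearly dependent) when, for every $x\in U$, the space $\{f\in\mathcal{S}: f(x)=0\}$ has dimension at least $c$; LLD means $1$-LLD. The dual operator space of $\mathcal{S}$ is $\widehat{\mathcal{S}}:=\{\,[f\mapsto f(x)]\mid x\in U\}\subset\mathcal{L}(\mathcal{S},V)$. An operator $\varphi\in\widehat{\mathcal{S}}$ is rank-optimal when it has the greatest rank among the elements of $\widehat{\mathcal{S}}$. Note that $\operatorname{Ker}\varphi\subset\mathcal{S}$, so that its elements are operators from $U$ to $V$. *)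

(* Defs.v *)
From HB Require Import structures.
From mathcomp Require Import all_boot all_order all_algebra.
From mathcomp Require Import boolp classical_sets functions cardinality.
Set Implicit Arguments.
Unset Strict Implicit.
Unset Printing Implicit Defensive.
Import GRing.Theory.
Local Open Scope classical_set_scope.
Local Open Scope ring_scope.

(* MathComp puts no module structure on [{linear U -> V}]. It is obtained here
   from the pointwise one on [U -> V], so that L(U, V) is an [lmodType]. *)
Section LinearOperators.
Context {K : fieldType} {U V : lmodType K}.

Definition linear_pred : {pred U -> V} := mem [set f : U -> V | linear f].

Lemma linear_predP (f : {linear U -> V}) : (f : U -> V) \in linear_pred.
Proof. by apply/mem_set; exact: linearP. Qed.

Definition linear_sub (f : U -> V) (fP : f \in linear_pred) : {linear U -> V} :=
  HB.pack f (GRing.isLinear.Build K U V *:%R f (set_mem fP)).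

Lemma linear_subE (f : U -> V) (fP : f \in linear_pred) :
  linear_sub fP = f :> (U -> V).
Proof. by []. Qed.

Lemma linear_ext (f g : {linear U -> V}) : f = g :> (U -> V) -> f = g.
Proof.
case: f g => [f [[fD] [fZ]]] [g [[gD] [gZ]]] /= fg.
case: _ / fg in gD gZ *.
by rewrite (Prop_irrelevance fD gD) (Prop_irrelevance fZ gZ).
Qed.

Lemma linear_rect (P : {linear U -> V} -> Type) :
  (forall f (fP : f \in linear_pred), P (linear_sub fP)) -> forall f, P f.
Proof.
move=> Psub f; have -> : f = linear_sub (linear_predP f) by exact: linear_ext.
exact: Psub.
Qed.

HB.instance Definition _ :=
  isSub.Build (U -> V) linear_pred {linear U -> V} linear_rect linear_subE.
HB.instance Definition _ := [Choice of {linear U -> V} by <:].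

Lemma linear_pred_submod_closed : submod_closed linear_pred.
Proof.
split; first by apply/mem_set => a u v /=; rewrite /GRing.zero /= /cst scaler0 addr0.
move=> a f g /set_mem /= lf /set_mem /= lg; apply/mem_set => /= b u v.
by rewrite !fctE lf lg !scalerDr !scalerA mulrC addrACA.
Qed.

HB.instance Definition _ :=
  GRing.isSubmodClosed.Build K (U -> V) linear_pred linear_pred_submod_closed.
HB.instance Definition _ := [SubChoice_isSubLmodule of {linear U -> V} by <:].

End LinearOperators.

(* A linear subspace of E is an [S : submodClosed E]; this is its carrier, as an
   [lmodType], so that one can speak of linear maps defined on S. *)
Section SubspaceType.
Context {K : fieldType} {E : lmodType K} (S : submodClosed E).

Record subspace : Type :=
  Subspace { subspace_val :> E; subspace_valP : subspace_val \in S }.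

HB.instance Definition _ := [isSub for subspace_val].
HB.instance Definition _ := [Choice of subspace by <:].
HB.instance Definition _ := [SubChoice_isSubLmodule of subspace by <:].

End SubspaceType.

Section Dimension.
Context {K : fieldType} {E : lmodType K}.
Implicit Types W : set E.

Definition lin_comb d (b : 'I_d -> E) (c : 'I_d -> K) : E :=
  \sum_(i < d) c i *: b i.

Definition lin_indep d (b : 'I_d -> E) : Prop :=
  forall c : 'I_d -> K, lin_comb b c = 0 -> forall i, c i = 0.

Definition has_dim W d : Prop :=
  exists b : 'I_d -> E, lin_indep b /\ W = range (lin_comb b).

(* [dim_le] and [dim_lt] assert in particular that the dimension is finite. *)
Definition dim_le W m : Prop := exists2 d, has_dim W d & (d <= m)%N.

Definition dim_lt W m : Prop := exists2 d, has_dim W d & (d < m)%N.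

Definition dim_ge W m : Prop :=
  exists b : 'I_m -> E, (forall i, W (b i)) /\ lin_indep b.

End Dimension.

Section Operators.
Context {K : fieldType} {U V : lmodType K}.

Definition has_rank (f : {linear U -> V}) r : Prop := has_dim (range f) r.
Definition rank_le (f : {linear U -> V}) m : Prop := dim_le (range f) m.
Definition rank_lt (f : {linear U -> V}) m : Prop := dim_lt (range f) m.

Definition op_ker (f : {linear U -> V}) : set U := [set x | f x = 0].

Definition rank_optimal (T : set {linear U -> V}) (phi : {linear U -> V}) :=
  T phi /\
  exists2 r, has_rank phi r & forall psi, T psi -> rank_le psi r.

End Operators.

Section LLD.
Context {K : fieldType} {U V : lmodType K} (S : submodClosed {linear U -> V}).

(* Finite-dimensionality of S is not part of [LLD]. *)
Definition LLD (c : nat) : Prop :=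
  forall x : U, dim_ge [set f : {linear U -> V} | f \in S /\ f x = 0] c.

Definition dual_op (x : U) (f : subspace S) : V := subspace_val f x.

Lemma dual_op_linear x : linear (dual_op x).
Proof. by []. Qed.

HB.instance Definition _ x :=
  GRing.isLinear.Build K (subspace S) V *:%R (dual_op x) (dual_op_linear x).

Definition dual_op_space : set {linear subspace S -> V} :=
  range (fun x => dual_op x : {linear subspace S -> V}).

End LLD.

Arguments dual_op_space {K U V} S.

(* Main.v *)
(* In coordinates, S is a pencil [M a = \sum_i a_i M_i] of matrices with n rows,
   all of rank less than n; M a has rank n - 1 at the rank-optimal operator,
   f spans its left kernel, and f is assumed to have rank at least n - 1.
   - Since #K >= n, the bound on the rank persists over every extension of K,
     in particular over L = K(t).
   - Over an infinite field, if M x has rank n - 1 and left kernel spanned by h,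
     the first-order variation of M at x shows that h takes its values in the
     row space of M x; thus h has rank at most n - 1.
   - The values of f therefore fill the row space of M a, and this allows one to
     solve h M(x) = 0 for h = f + t g, with g arbitrary in S, by a vector x over L
     which reduces to a at t = 0, so that M x still has rank n - 1.
   Hence f + t g has rank at most n - 1 over L, and comparing the coefficients
   of highest degree in t of its minors, so does g. *)
From HB Require Import structures.
Require Import Defs.
From mathcomp Require Import all_boot all_order all_algebra perm.
From mathcomp Require Import boolp classical_sets functions cardinality.
Set Implicit Arguments.
Unset Strict Implicit.
Unset Printing Implicit Defensive.
Import GRing.Theory.
Local Open Scope classical_set_scope.
Local Open Scope ring_scope.

(** * Determinants along a line of matrices *)

Lemma size_coef_prod_linear (R : comNzRingType) n (a b : 'I_n -> R) :
  (size (\prod_i ((a i)%:P + (b i) *: 'X))%R <= n.+1)%N /\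
  (\prod_i ((a i)%:P + (b i) *: 'X))`_n = \prod_i b i.
Proof.
elim: n a b => [|n IHn] a b; first by rewrite !big_ord0 size_poly1 coef1.
rewrite !big_ord_recl; have [] := IHn (a \o lift ord0) (b \o lift ord0).
set p := \prod_i _ => sp cp.
rewrite mulrDl; split.
  apply: leq_trans (size_polyD _ _) _; rewrite geq_max mul_polyC.
  rewrite (leq_trans (size_scale_leq _ _)) ?(leq_trans sp) //=.
  rewrite -scalerAl (leq_trans (size_scale_leq _ _)) //.
  rewrite (leq_trans (size_polyMleq _ _)) // size_polyX /=; exact: sp.
rewrite coefD mul_polyC -scalerAl !coefZ mulrC coefXM /= cp.
by rewrite nth_default // mul0r add0r.
Qed.

Definition det_line_poly (R : comNzRingType) n (A B : 'M[R]_n) : {poly R} :=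
  \det (map_mx polyC A + 'X *: map_mx polyC B).

Section DetLine.
Variables (R : idomainType) (n : nat) (A B : 'M[R]_n).

Lemma det_line_polyE x : (det_line_poly A B).[x] = \det (A + x *: B).
Proof.
rewrite -horner_evalE -det_map_mx; congr (\det _); apply/matrixP => i j.
by rewrite !mxE /= /horner_eval !hornerE.
Qed.

Lemma size_coef_det_line_poly :
  (size (det_line_poly A B) <= n.+1)%N /\ (det_line_poly A B)`_n = \det B.
Proof.
have E (s : 'S_n) : \prod_i (map_mx polyC A + 'X *: map_mx polyC B) i (s i)
    = \prod_i ((A i (s i))%:P + B i (s i) *: 'X).
  by apply: eq_bigr => i _; rewrite !mxE mulrC mul_polyC.
split.
  apply: leq_trans (size_sum _ _ _) _; apply/bigmax_leqP => s _.
  by rewrite size_Msign E (size_coef_prod_linear _ _).1.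
rewrite coef_sum; apply: eq_bigr => s _; rewrite E.
by case: (odd_perm s); rewrite ?expr1 ?expr0 ?mulN1r ?mul1r ?coefN
   (size_coef_prod_linear _ _).2.
Qed.

(** The degree is at most [n] and the coefficient of degree [n] is [\det B]; once the latter
    vanishes, [n] roots suffice instead of n + 1. *)
Lemma det_line_eq0 (z : 'I_n -> R) : injective z ->
  (forall i, \det (A + z i *: B) = 0) -> \det B = 0 ->
  forall x, \det (A + x *: B) = 0.
Proof.
move=> zI Az B0 x; have [sp cp] := size_coef_det_line_poly.
suff p0 : det_line_poly A B = 0 by rewrite -det_line_polyE p0 horner0.
apply: (@roots_geq_poly_eq0 _ _ (codom z)).
- by apply/allP => _ /codomP[i ->]; rewrite /root det_line_polyE Az.
- exact/injectiveP.
rewrite size_codom card_ord; apply/leq_sizeP => j.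
by rewrite leq_eqVlt => /orP[/eqP <-|nj]; [rewrite cp|exact: leq_sizeP nj].
Qed.

(** The factor ['X] supplies a root at 0, so that the product vanishes on the whole of an infinite
    domain. *)
Lemma det_line_near0 (z : nat -> R) : injective z ->
  (forall x, x != 0 -> \det (A + x *: B) = 0) -> \det A = 0.
Proof.
move=> zI AB0; have -> : A = A + 0 *: B by rewrite scale0r addr0.
rewrite -det_line_polyE; suff /eqP: 'X * det_line_poly A B = 0.
  by rewrite mulf_eq0 polyX_eq0 /= => /eqP ->; rewrite horner0.
set p := _ * _; apply: (@roots_geq_poly_eq0 _ p (mkseq z (size p))).
- apply/allP => x _; rewrite /root hornerM hornerX det_line_polyE.
  by have [->|/AB0 ->] := eqVneq x 0; rewrite ?mul0r ?mulr0.
- by apply: mkseq_uniq.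
by rewrite size_mkseq.
Qed.

End DetLine.

(** * Rank, left kernels and first-order variation *)

(** Plays the role of a nonzero minor of order [k]: the determinant of [P *m A *m Q] can be followed
    through ring morphisms. *)
Lemma mxrank_geP (F : fieldType) k m n (A : 'M[F]_(m, n)) :
  reflect (exists P : 'M_(k, m), exists Q : 'M_(n, k), P *m A *m Q = 1%:M)
          (k <= \rank A)%N.
Proof.
apply: (iffP idP) => [kA|[P [Q PAQ]]]; last first.
  rewrite -{1}(mxrank1 F k) -PAQ.
  by rewrite (leq_trans (mxrankM_maxl _ _)) ?mxrankM_maxr.
exists (pid_mx k *m invmx (col_ebase A)), (invmx (row_ebase A) *m pid_mx k).
rewrite -{2}(mulmx_ebase A) !mulmxA mulmxKV ?col_ebase_unit //.
rewrite mulmxK ?row_ebase_unit // !mul_pid_mx.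
have [mA nA] : (\rank A <= m /\ \rank A <= n)%N by rewrite rank_leq_row rank_leq_col.
have -> : minn n (minn (minn m (minn k (\rank A))) k) = k.
  rewrite (minn_idPl kA) (minn_idPr (leq_trans kA mA)) minnn.
  exact: minn_idPr (leq_trans kA nA).
exact: pid_mx_1.
Qed.

Lemma ker_line (F : fieldType) m n (A : 'M[F]_(m, n)) (h c : 'rV_m) :
  (m.-1 <= \rank A)%N -> h != 0 -> h *m A = 0 -> c *m A = 0 -> (c <= h)%MS.
Proof.
move=> rA h0 /eqP; rewrite -sub_kermx => hA /eqP; rewrite -sub_kermx => cA.
apply: submx_trans cA _; rewrite -(mxrank_leqif_sup hA) eqn_leq mxrankS //=.
rewrite mxrank_ker rank_rV h0 leq_subLR addn1.
exact: leq_trans (leqSpred m) _.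
Qed.

(* The pencil [X + x Y] is multiplied on the left by the matrix acting as
   [1 / x] along [h] and as the identity on a complement of [h]. *)
Lemma image_ker_pencil (F : fieldType) (z : nat -> F) m n (X Y : 'M[F]_(m, n))
    (h : 'rV_m) : injective z ->
  (forall x, \rank (X + x *: Y)%R < m)%N -> (m.-1 <= \rank X)%N ->
  h != 0 -> h *m X = 0 -> (h *m Y <= X)%MS.
Proof.
move=> zI rXY rX h0 hX; apply/negPn/negP => hY.
have [k hk] : exists k : 'cV_m, h *m k = 1%:M.
  by apply/row_freeP; rewrite /row_free rank_rV h0.
pose Z := (1%:M - k *m h) *m Y.
(* If c kills this matrix, then c X = - (c k) h Y. A nonzero c k puts h Y in the row space of X; if
   c k = 0, then c is a multiple of h, and h k = 1 makes it zero. *)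
have free : row_free (X + k *m h *m Y).
  apply/inj_row_free => c; rewrite mulmxDr !mulmxA -mulmxA => E.
  have [|ck0] := eqVneq (c *m k) 0; last first.
    case/negP: hY; apply/submxP.
    have {}ck0 : (c *m k) 0 0 != 0.
      by apply: contra ck0 => /eqP e; apply/eqP/rowP => i; rewrite !ord1 e mxE.
    exists (- ((c *m k) 0 0)^-1 *: c); rewrite -scalemxAl.
    have -> : c *m X = - ((c *m k) 0 0 *: (h *m Y)).
      by apply/eqP; rewrite -addr_eq0 -mul_scalar_mx -mx11_scalar E.
    by rewrite scalerN scaleNr opprK scalerA mulVf // scale1r.
  move=> ck0; move: E; rewrite ck0 mul0mx addr0 => cX.
  have /sub_rVP[a ca] := ker_line rX h0 hX cX.
  move: ck0; rewrite ca -scalemxAl hk => /matrixP/(_ 0 0).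
  by rewrite !mxE eqxx mulr1 => ->; rewrite scale0r.
have [Q XQ] := row_freeP free.
suff: \det ((X + k *m h *m Y) *m Q) = 0.
  by rewrite XQ det1 => /eqP; rewrite oner_eq0.
(* For x != 0, X + k h Y + x Z is the rescaled pencil, of rank less than [m]; the value at x = 0
   follows. *)
rewrite mulmxDl; apply: (@det_line_near0 _ _ _ (Z *m Q) z) => // x x0.
rewrite -mulmxDl scalemxAl -mulmxDl.
set R := _ + _; have -> : R = (1%:M - k *m h + x^-1 *: (k *m h)) *m (X + x *: Y).
  rewrite mulmxDr !mulmxDl mul1mx !mulNmx -!scalemxAl -(mulmxA k h X) hX.
  rewrite mulmx0 scaler0 addr0 oppr0 addr0 /R -addrA; congr (_ + _).
  rewrite mul1mx -!scalemxAr scalerA mulVf // scale1r /Z mulmxDl mul1mx mulNmx.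
  by rewrite scalerDr scalerN addrC.
apply: contraTeq (rXY x) => D0; rewrite -leqNgt.
have /mxrank_unit rm : (1%:M - k *m h + x^-1 *: (k *m h)) *m (X + x *: Y) *m Q
    \in unitmx by rewrite unitmxE unitfE.
rewrite -[X in (X <= _)%N]rm.
exact: leq_trans (mxrankM_maxl _ _) (mxrankM_maxr _ _).
Qed.

(** * Pencils of matrices and scalar extension *)

Definition pencil (R : comNzRingType) m n p (M : 'I_p -> 'M[R]_(m, n))
    (a : 'rV[R]_p) : 'M[R]_(m, n) := \sum_i a 0 i *: M i.

(** The rows are the values, at the points indexed by i, of the operator with coordinates [g],
    whereas [pencil M a] is evaluation at the combination [a] of these points. *)
Definition pencil_op (R : comNzRingType) m n p (M : 'I_p -> 'M[R]_(m, n))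
    (g : 'rV[R]_m) : 'M[R]_(p, n) := \matrix_i (g *m M i).

Section Pencil.
Variables (R : comNzRingType) (m n p : nat) (M : 'I_p -> 'M[R]_(m, n)).
Implicit Types (a : 'rV[R]_p) (g : 'rV[R]_m).

Lemma mul_pencil a g : g *m pencil M a = a *m pencil_op M g.
Proof.
rewrite mulmx_sumr mulmx_sum_row; apply: eq_bigr => i _.
by rewrite -scalemxAr rowK.
Qed.

Lemma pencilD a b : pencil M (a + b) = pencil M a + pencil M b.
Proof. by rewrite -big_split; apply: eq_bigr => i _; rewrite mxE scalerDl. Qed.

Lemma pencilZ x a : pencil M (x *: a) = x *: pencil M a.
Proof. by rewrite scaler_sumr; apply: eq_bigr => i _; rewrite mxE scalerA. Qed.

Lemma pencil_delta i : pencil M (delta_mx 0 i) = M i.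
Proof.
rewrite /pencil (bigD1 i) //= mxE !eqxx scale1r big1 ?addr0 // => j ji.
by rewrite mxE (negPf ji) andbF scale0r.
Qed.

Lemma pencil_opD g h : pencil_op M (g + h) = pencil_op M g + pencil_op M h.
Proof. by apply/row_matrixP => i; rewrite linearD /= !rowK mulmxDl. Qed.

Lemma pencil_opZ x g : pencil_op M (x *: g) = x *: pencil_op M g.
Proof. by apply/row_matrixP => i; rewrite linearZ /= !rowK scalemxAl. Qed.

Lemma pencil_mulmxr q (Q : 'M_(n, q)) a :
  pencil (fun i => M i *m Q) a = pencil M a *m Q.
Proof. by rewrite mulmx_suml; apply: eq_bigr => i _; rewrite scalemxAl. Qed.

Variables (S : comNzRingType) (f : {rmorphism R -> S}).

Lemma map_pencil a :
  map_mx f (pencil M a) = pencil (fun i => map_mx f (M i)) (map_mx f a).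
Proof.
by rewrite map_mx_sum; apply: eq_bigr => i _; rewrite map_mxZ mxE.
Qed.

Lemma map_pencil_op g :
  map_mx f (pencil_op M g) = pencil_op (fun i => map_mx f (M i)) (map_mx f g).
Proof. by apply/row_matrixP => i; rewrite -map_row !rowK map_mxM. Qed.

End Pencil.

Section Extension.
Variables (K L : fieldType) (f : {rmorphism K -> L}).

(* The coordinates are moved from [K] to [L] one at a time. Along each of them
   the determinant has degree less than [n], its coefficient of degree [n] being
   the value at a basis vector. *)
Lemma det_pencil_ext n p (N : 'I_p -> 'M[L]_n) (z : 'I_n -> K) : injective z ->
  (forall a : 'rV[K]_p, \det (pencil N (map_mx f a)) = 0) ->
  forall a : 'rV[L]_p, \det (pencil N a) = 0.
Proof.
move=> zI NK a.
pose mix k (c : 'rV[K]_p) := \row_i (if (i < k)%N then a 0 i else f (c 0 i)).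
suff mix0 k : (k <= p)%N -> forall c, \det (pencil N (mix k c)) = 0.
  rewrite -(mix0 p (leqnn _) 0); congr (\det (pencil N _)).
  by apply/rowP => i; rewrite mxE ltn_ord.
elim: k => [_ c|k IHk kp c].
  rewrite -[RHS](NK c); congr (\det (pencil N _)).
  by apply/rowP => i; rewrite !mxE.
pose j := Ordinal kp.
pose c0 := \row_i (if i == j then 0 else c 0 i).
have mixE x : mix k (c0 + x *: delta_mx 0 j) = mix k c0 + f x *: delta_mx 0 j.
  apply/rowP => i; rewrite !mxE eqxx /=; have [->|ij] := eqVneq i j.
    by rewrite ltnn mulr1 add0r rmorph0 add0r mulr1.
  by case: ifP; rewrite mulr0n !mulr0 !addr0.
have -> : mix k.+1 c = mix k c0 + a 0 j *: delta_mx 0 j.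
  apply/rowP => i; rewrite !mxE eqxx /= ltnS leq_eqVlt -[_ == k]/(i == j).
  have [->|ij] := eqVneq i j; first by rewrite ltnn rmorph0 add0r mulr1.
  by rewrite mulr0n mulr0 addr0.
rewrite pencilD pencilZ pencil_delta.
apply: (det_line_eq0 (z := f \o z)) => [|i|].
- exact: inj_comp (fmorph_inj f) zI.
- by rewrite -pencil_delta -pencilZ -pencilD -mixE IHk // ltnW.
rewrite -pencil_delta -[RHS](NK (delta_mx 0 j)); congr (\det (pencil N _)).
by rewrite map_delta_mx.
Qed.

(** Full rank would give a right inverse [Q] over [L]; the determinant of the pencil times [Q]
    vanishes at the points of [K], hence everywhere. This is why [det_pencil_ext] allows
    coefficients in [L]. *)
Lemma rank_pencil_ext m n p (M : 'I_p -> 'M[K]_(m, n)) (z : 'I_m -> K) :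
  injective z -> (forall a, \rank (pencil M a) < m)%N ->
  forall a, (\rank (pencil (fun i => map_mx f (M i)) a) < m)%N.
Proof.
move=> zI MK a; rewrite ltn_neqAle rank_leq_row andbT.
apply/negP => /row_freeP[Q MQ].
suff: \det (pencil (fun i => map_mx f (M i) *m Q) a) = 0.
  by rewrite pencil_mulmxr MQ det1 => /eqP; rewrite oner_eq0.
apply: (det_pencil_ext zI) => c; rewrite pencil_mulmxr -map_pencil.
apply: contraTeq (MK c) => D0; rewrite -leqNgt.
have /mxrank_unit rm : map_mx f (pencil M c) *m Q \in unitmx.
  by rewrite unitmxE unitfE.
by rewrite -[X in (X <= _)%N]rm -(mxrank_map f) mxrankM_maxl.
Qed.

End Extension.

(** * Rank of the dual pencil *)

(** Moving [a] along the i-th basis vector gives the pencil M a + x M_i, to which [image_ker_pencil]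
    applies row by row. *)
Lemma pencil_op_sub (F : fieldType) (z : nat -> F) m n p
    (M : 'I_p -> 'M[F]_(m, n)) (a : 'rV_p) (h : 'rV_m) : injective z ->
  (forall b, \rank (pencil M b) < m)%N -> (m.-1 <= \rank (pencil M a))%N ->
  h != 0 -> h *m pencil M a = 0 -> (pencil_op M h <= pencil M a)%MS.
Proof.
move=> zI Mb Ma h0 ha; apply/row_subP => i; rewrite rowK.
apply: (image_ker_pencil zI) => // x.
by rewrite -pencil_delta -pencilZ -pencilD.
Qed.

(* [x / \det D] is the solution, as a power series in [t] with constant term [a],
   of [x *m (A + t B) *m E = 0]. *)
Lemma ker_perturbation (R : comNzRingType) p n (t : R) (A B : 'M[R]_(p, n))
    (E : 'M_n) (s : 'M_(n, p)) (a : 'rV_p) :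
  E *m E = E -> A *m E = A -> s *m A = E -> a *m A = 0 ->
  a *m B *m E = a *m B ->
  let D := 1%:M + t *: (s *m B *m E) in
  (\det D *: a - t *: (a *m B *m \adj D *m s)) *m (A + t *: B) *m E = 0.
Proof.
move=> EE AE sA aA aBE D.
have [w Ew] : exists w, w = - (t *: (a *m B *m \adj D)) by eexists.
have wD : w *m D = - ((t * \det D) *: (a *m B)).
  by rewrite Ew mulNmx -scalemxAl -(mulmxA _ _ D) mul_adj_mx mul_mx_scalar scalerA.
(* Both terms of w = w D - t w s B E are fixed by [E]. *)
have wE : w *m E = w.
  have Dw : w = - ((t * \det D) *: (a *m B)) - t *: (w *m s *m B *m E).
    by rewrite -wD mulmxDr mulmx1 -scalemxAr !mulmxA addrK.
  rewrite [in LHS]Dw [in RHS]Dw mulmxDl !mulNmx -!scalemxAl aBE.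
  by rewrite -(mulmxA _ E E) EE.
have -> : \det D *: a - t *: (a *m B *m \adj D *m s) = \det D *: a + w *m s.
  by rewrite Ew mulNmx -scalemxAl.
rewrite -mulmxA (mulmxDl A) AE -scalemxAl mulmxDl !mulmxDr -!scalemxAl -!scalemxAr.
rewrite aA scaler0 add0r -(mulmxA w) sA wE mulmxA aBE.
rewrite (_ : w + _ = w *m D); last by rewrite mulmxDr mulmx1 -scalemxAr !mulmxA.
by rewrite wD scalerA mulrC subrr.
Qed.

Section Generic.
Variables (K : fieldType) (m n p : nat) (M : 'I_p -> 'M[K]_(m, n)).
Variables (z : 'I_m -> K) (zI : injective z).
Hypothesis M_lt : forall a, (\rank (pencil M a) < m)%N.
Variables (a : 'rV[K]_p) (f : 'rV[K]_m).
Hypotheses (rk_a : (m.-1 <= \rank (pencil M a))%N) (f0 : f != 0).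
Hypotheses (fa : f *m pencil M a = 0) (rk_f : (m.-1 <= \rank (pencil_op M f))%N).

(** The indeterminate is t: identities are proved over K[t], where [ev0] sets t = 0, and ranks are
    taken over K(t). *)
Local Notation P := {poly K}.
Local Notation L := {fraction P}.
Local Notation C := (map_mx (@polyC K)).
Local Notation toL := (map_mx (@tofrac P)).
Let iota : {rmorphism K -> L} := @tofrac P \o polyC.
Let ML i := map_mx iota (M i).
Let MP i := C (M i).

(** [L] is infinite even when [K] is finite. *)
Let zL_inj : injective (fun i : nat => tofrac 'X^i : L).
Proof.
move=> i j /eqP; rewrite tofrac_eq => /eqP/(congr1 (size \o val)) /=.
by rewrite !size_polyXn => -[].
Qed.

Let ML_lt : forall b, (\rank (pencil ML b) < m)%N.
Proof. exact: (rank_pencil_ext iota zI). Qed.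

Let toLC k l (A : 'M[K]_(k, l)) : toL (C A) = map_mx iota A.
Proof. by apply/matrixP => i j; rewrite !mxE. Qed.

Let map_MP b : toL (pencil MP b) = pencil ML (toL b).
Proof.
by rewrite map_pencil; apply: eq_bigr => i _; rewrite /MP toLC.
Qed.

Let map_MP_op h : toL (pencil_op MP h) = pencil_op ML (toL h).
Proof.
by rewrite map_pencil_op; apply/row_matrixP => i; rewrite !rowK /MP toLC.
Qed.

Let ev0 : {rmorphism P -> K} := horner_eval 0.

Let ev0C k l (A : 'M[K]_(k, l)) : map_mx ev0 (C A) = A.
Proof. by apply/matrixP => i j; rewrite !mxE /= /horner_eval hornerC. Qed.

Let ev0X : ev0 'X = 0.
Proof. by rewrite /= /horner_eval hornerX. Qed.

(** The inclusion is proved over [L], since [K] may be finite, and descends to [K]. Equality holds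
    because the left side has rank at least m - 1 and the right side at most that. *)
Lemma pencil_op_eqmx : (pencil_op M f :=: pencil M a)%MS.
Proof.
have le : (pencil_op M f <= pencil M a)%MS.
  rewrite -(map_submx iota) map_pencil_op map_pencil.
  apply: (pencil_op_sub zL_inj ML_lt); rewrite -?map_pencil ?mxrank_map //.
    by rewrite map_mx_eq0.
  by rewrite -map_mxM fa map_mx0.
apply/eqmxP; rewrite le /= -(mxrank_leqif_sup le) eqn_leq mxrankS //=.
apply: leq_trans rk_f; rewrite -ltnS; apply: leq_trans (M_lt a) _.
exact: leqSpred.
Qed.

Lemma rank_pencil_op_lt_nz g : (\rank (pencil_op M g) < m)%N.
Proof.
(* A projection onto the row space of M a, which is also that of [pencil_op M f]. *)
pose E := pinvmx (pencil M a) *m pencil M a.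
have subE k (A : 'M_(k, n)) : (A <= pencil M a)%MS -> A *m E = A.
  by move=> Aa; rewrite mulmxA mulmxKpV.
have Ea : (E <= pencil M a)%MS by rewrite submxMl.
have /submxP[s Es] : (E <= pencil_op M f)%MS by rewrite pencil_op_eqmx.
pose D := 1%:M + 'X *: (C s *m C (pencil_op M g) *m C E).
pose x := \det D *: C a
          - 'X *: (C a *m C (pencil_op M g) *m \adj D *m C s).
pose h := C f + 'X *: C g.
have opC b : pencil_op MP (C b) = C (pencil_op M b).
  by rewrite map_pencil_op.
have hxE : h *m pencil MP x *m C E = 0.
  rewrite mul_pencil pencil_opD pencil_opZ !opC.
  apply: ker_perturbation; rewrite -!map_mxM.
  - by rewrite subE.
  - by rewrite subE // pencil_op_eqmx.
  - by rewrite -Es.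
  - by rewrite -mul_pencil fa map_mx0.
  by rewrite -mul_pencil subE // submxMl.
have x0 : map_mx ev0 x = a.
  rewrite map_mxB !map_mxZ ev0X scale0r subr0 ev0C -det_map_mx map_mxD map_mxZ.
  by rewrite ev0X scale0r addr0 map_mx1 det1 scale1r.
have h0 : toL h != 0.
  apply: contra f0 => /eqP hE; suff -> : f = map_mx ev0 h.
    suff -> : h = 0 by rewrite map_mx0.
    apply/matrixP => i j; move/matrixP: hE => /(_ i j).
    by rewrite !mxE => /eqP; rewrite tofrac_eq0 => /eqP.
  by rewrite map_mxD map_mxZ ev0X scale0r addr0 ev0C.
(* At t = 0 this matrix becomes M a, so a determinant of order m - 1 is nonzero there, hence is a
   nonzero polynomial. *)
have rkE : (m.-1 <= \rank (pencil ML (toL x) *m toL (C E)))%N.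
  have /mxrank_geP[A [B AB]] := rk_a.
  apply: leq_trans _ (mxrankM_maxr (toL (C A)) _).
  apply: leq_trans _ (mxrankM_maxl _ (toL (C B))).
  rewrite -map_MP -!map_mxM; set N := C A *m _ *m _.
  suff dN : \det N != 0.
    suff /mxrank_unit -> : toL N \in unitmx by [].
    by rewrite unitmxE unitfE det_map_mx tofrac_eq0.
  apply/negP => /eqP /(congr1 ev0); rewrite -det_map_mx rmorph0 !map_mxM !ev0C.
  rewrite map_pencil x0 (_ : pencil _ a = pencil M a); last first.
    by apply: eq_bigr => i _; rewrite ev0C.
  by rewrite subE // AB det1 => /eqP; rewrite oner_eq0.
have rkx : (m.-1 <= \rank (pencil ML (toL x)))%N.
  exact: leq_trans rkE (mxrankM_maxl _ _).
(* The factor [E] of [hxE] is removed: some nonzero c kills M(x), hence M(x) E, whose left kernel is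
   a line containing h; so h is a multiple of c. *)
have hx : toL h *m pencil ML (toL x) = 0.
  have: kermx (pencil ML (toL x)) != 0.
    by rewrite kermx_eq0 /row_free neq_ltn ML_lt.
  move=> /rowV0Pn[c]; rewrite sub_kermx => /eqP cx c0.
  suff /sub_rVP[k ->] : (toL h <= c)%MS by rewrite -scalemxAl cx scaler0.
  apply: (ker_line rkE c0); rewrite mulmxA; first by rewrite cx mul0mx.
  by rewrite -map_MP -!map_mxM hxE map_mx0.
have rkh : (\rank (pencil_op ML (toL h)) < m)%N.
  apply: leq_ltn_trans (ML_lt (toL x)); apply: mxrankS.
  exact: (pencil_op_sub zL_inj).
(* If A g B = 1, then A (f + t g) B = t + A f B, whose determinant is the characteristic polynomial
   of - A f B: monic, hence nonzero. *)
rewrite ltnNge; apply/negP => /mxrank_geP[A [B AB]].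
suff : \det (toL (C A) *m pencil_op ML (toL h) *m toL (C B)) == 0.
  rewrite -map_MP_op -!map_mxM det_map_mx tofrac_eq0 pencil_opD pencil_opZ !opC.
  rewrite mulmxDr mulmxDl -scalemxAr -scalemxAl -!map_mxM AB map_mx1.
  rewrite scalemx1 addrC.
  rewrite (_ : 'X%:M + _ = char_poly_mx (- (A *m pencil_op M f *m B))).
    by rewrite -[\det _]/(char_poly _) (negPf (monic_neq0 (char_poly_monic _))).
  by rewrite /char_poly_mx map_mxN opprK.
apply/eqP; apply: contraTeq rkh => D0; rewrite -leqNgt; apply/mxrank_geP.
exists (toL (C A)).
exists (toL (C B) *m invmx (toL (C A) *m pencil_op ML (toL h) *m toL (C B))).
by rewrite mulmxA mulmxV // unitmxE unitfE.
Qed.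

End Generic.

(** The remaining case f = 0 is degenerate: it forces m <= 1, so every M_i is zero. *)
Lemma rank_pencil_op_lt (K : fieldType) m n p (M : 'I_p -> 'M[K]_(m, n))
    (z : 'I_m -> K) (a : 'rV_p) (f g : 'rV_m) : injective z ->
  (forall b, \rank (pencil M b) < m)%N -> (m.-1 <= \rank (pencil M a))%N ->
  f *m pencil M a = 0 -> (m.-1 <= \rank (pencil_op M f))%N ->
  (\rank (pencil_op M g) < m)%N.
Proof.
move=> zI M_lt rk_a fa rk_f; have [f0|f0] := eqVneq f 0; last first.
  exact: (rank_pencil_op_lt_nz zI M_lt rk_a f0 fa rk_f).
have m1 : (m <= 1)%N.
  rewrite (leq_trans (leqSpred m)) // ltnS (leq_trans rk_f) // f0 leqn0.
  by rewrite mxrank_eq0; apply/eqP/row_matrixP => i; rewrite rowK mul0mx row0.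
suff -> : pencil_op M g = 0 by rewrite mxrank0 (leq_ltn_trans _ (M_lt 0)).
apply/row_matrixP => i; rewrite rowK row0 (_ : M i = 0) ?mulmx0 //.
apply/eqP; rewrite -mxrank_eq0 -leqn0 -ltnS -pencil_delta.
exact: leq_trans (M_lt _) m1.
Qed.

(** * Coordinates *)

Section Coordinates.
Variables (K : fieldType) (E : lmodType K).
Implicit Type W : set E.

Definition row_comb m (v : 'I_m -> E) (r : 'rV[K]_m) : E := lin_comb v (r 0).

Lemma lin_combE m (v : 'I_m -> E) c : lin_comb v c = row_comb v (\row_i c i).
Proof. by apply: eq_bigr => i _; rewrite mxE. Qed.

Lemma row_comb_linear m (v : 'I_m -> E) : linear (row_comb v).
Proof.
move=> a r s; rewrite /row_comb /lin_comb scaler_sumr -big_split.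
by apply: eq_bigr => i _; rewrite !mxE scalerDl scalerA.
Qed.

HB.instance Definition _ m (v : 'I_m -> E) :=
  GRing.isLinear.Build K 'rV[K]_m E *:%R (row_comb v) (row_comb_linear v).

Lemma row_comb_mul d m (v : 'I_m -> E) (A : 'M_(d, m)) r :
  row_comb (fun i => row_comb v (row i A)) r = row_comb v (r *m A).
Proof.
rewrite mulmx_sum_row linear_sum; apply: eq_bigr => i _.
by rewrite linearZ.
Qed.

Lemma row_comb_inj m (v : 'I_m -> E) : lin_indep v -> injective (row_comb v).
Proof.
move=> vI r s /eqP; rewrite -subr_eq0 -linearB => /eqP /vI rs.
by apply/rowP => i; have /eqP := rs i; rewrite !mxE subr_eq0 => /eqP.
Qed.

Lemma lin_indep_row m (v : 'I_m -> E) :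
  (forall r, row_comb v r = 0 -> r = 0) -> lin_indep v.
Proof.
move=> vI c; rewrite lin_combE => /vI /rowP c0 i.
by have := c0 i; rewrite !mxE.
Qed.

Lemma lin_indep_comp d m (v : 'I_m -> E) (A : 'M_(d, m)) : lin_indep v ->
  lin_indep (fun i => row_comb v (row i A)) <-> row_free A.
Proof.
move=> vI; split=> [AI|Afree].
  apply/inj_row_free => r rA; apply: (row_comb_inj AI).
  by rewrite row_comb_mul rA !linear0.
apply: lin_indep_row => r; rewrite row_comb_mul -(linear0 (row_comb v)).
by move=> /(row_comb_inj vI); rewrite -(mul0mx _ A) => /(row_free_inj Afree).
Qed.

(** Dictionary between dimensions and ranks: since [v] is free, a family of combinations is free
    exactly when its coordinate matrix is row-free. *)
Lemma dim_ge_row_comb d q m (v : 'I_m -> E) (A : 'M_(q, m)) : lin_indep v ->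
  dim_ge (range (fun r => row_comb v (r *m A))) d <-> (d <= \rank A)%N.
Proof.
move=> vI; split=> [[b [bA bI]]|/mxrank_geP[P [Q PAQ]]].
  have /choice[c cE] i : exists r, row_comb v (r *m A) = b i.
    by have [r _ rE] := bA i; exists r.
  pose C := \matrix_i c i.
  have /(lin_indep_comp (C *m A) vI) : lin_indep (fun i => row_comb v (row i (C *m A))).
    rewrite (_ : (fun _ => _) = b) //; apply/funext => i.
    by rewrite row_mul rowK cE.
  by rewrite /row_free => /eqP <-; rewrite mxrankM_maxr.
exists (fun i => row_comb v (row i (P *m A))); split.
  by move=> i; exists (row i P) => //; rewrite row_mul.
by apply/(lin_indep_comp _ vI)/row_freeP; exists Q.
Qed.

Lemma has_dim_ge W d e : has_dim W d -> dim_ge W e <-> (e <= d)%N.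
Proof.
move=> [b [bI ->]]; rewrite -[X in (_ <= X)%N](mxrank1 K) -(dim_ge_row_comb e _ bI).
rewrite (_ : range _ = range (fun r => row_comb b (r *m 1%:M))) //.
apply/seteqP; split=> _ [c _ <-].
  by exists (\row_i c i) => //; rewrite mulmx1 -lin_combE.
by exists (c 0) => //; rewrite mulmx1.
Qed.

Lemma lin_indep_extend m (v : 'I_m -> E) w : lin_indep v ->
  ~ range (row_comb v) w ->
  lin_indep (fun i => oapp v w (unlift ord0 i)).
Proof.
move=> vI vw c; rewrite /lin_comb big_ord_recl unlift_none /=.
under eq_bigr do rewrite liftK /=.
move=> c0; have c00 : c ord0 = 0.
  apply/eqP/negPn/negP => nz; apply: vw.
  exists (\row_i (- (c ord0)^-1 * c (lift ord0 i))) => //.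
  apply: (scalerI nz); rewrite -lin_combE /lin_comb.
  have -> : c ord0 *: w = - \sum_i c (lift ord0 i) *: v i.
    by apply/eqP; rewrite -addr_eq0 c0.
  rewrite -sumrN scaler_sumr; apply: eq_bigr => i _.
  by rewrite scalerA mulNr mulrN mulVKf // scaleNr.
move: c0; rewrite c00 scale0r add0r => /vI c0 i.
by case: (unliftP ord0 i) => [j ->|->].
Qed.

(** Although [E] may be infinite-dimensional, finitely many vectors can thus be treated as rows of a
    matrix. *)
Lemma finite_coordinates (s : seq E) : exists m, exists v : 'I_m -> E,
  lin_indep v /\ forall w, w \in s -> exists r, w = row_comb v r.
Proof.
elim: s => [|w s [m [v [vI vs]]]].
  by exists 0, (fun=> 0); split => // c _ [].
have [[r _ rw]|vw] := pselect (range (row_comb v) w).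
  exists m, v; split=> // u; rewrite inE => /orP[/eqP ->|/vs//].
  by exists r.
exists m.+1, (fun i => oapp v w (unlift ord0 i)); split.
  exact: lin_indep_extend.
move=> u; rewrite inE => /orP[/eqP ->|/vs[r ->]].
  exists (delta_mx 0 ord0); rewrite /row_comb /lin_comb big_ord_recl big1.
    by rewrite unlift_none mxE eqxx scale1r addr0.
  by move=> i _; rewrite mxE andbF scale0r.
exists (\row_i oapp (r 0) 0 (unlift ord0 i)).
rewrite /row_comb /lin_comb big_ord_recl mxE unlift_none scale0r add0r.
by apply: eq_bigr => i _; rewrite mxE liftK.
Qed.

(** A free family in [W] that cannot be enlarged spans [W]; if it had fewer than [m] vectors, the
    dimension would be less than [m]. *)
Lemma dim_lt_or_ge W m : (forall d (v : 'I_d -> E) r, (forall i, W (v i)) ->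
  W (row_comb v r)) -> ~ dim_lt W m -> dim_ge W m.
Proof.
move=> Wlin Wm; suff: forall k, (k <= m)%N -> dim_ge W k by apply.
elim=> [_|k IHk km]; first by exists (fun=> 0); split=> [[]|c _ []].
have [v [vW vI]] := IHk (ltnW km).
have [vfull|] := pselect (W `<=` range (row_comb v)).
  case: Wm; exists k => //; exists v; split=> //; apply/seteqP; split=> w.
    by move=> /vfull[r _ <-]; exists (r 0).
  by move=> [c _ <-]; rewrite lin_combE; apply: Wlin.
move=> /existsNP[w /not_implyP[Ww vw]].
exists (fun i => oapp v w (unlift ord0 i)); split.
  by move=> i; case: unliftP => [j _|_]; [apply: vW|].
exact: lin_indep_extend.
Qed.

End Coordinates.

(** * Ranges of operators and evaluation of combinations *)

Section Operators.
Variables (K : fieldType) (U V : lmodType K).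

Lemma range_dim_lt_or_ge (f : {linear U -> V}) m :
  ~ rank_lt f m -> dim_ge (range f) m.
Proof.
apply: dim_lt_or_ge => d v r vf.
have /choice[u uE] i : exists x, f x = v i by have [x _ <-] := vf i; exists x.
exists (row_comb u r) => //; rewrite linear_sum; apply: eq_bigr => i _.
by rewrite linearZ /= uE.
Qed.

Lemma row_comb_app n (b : 'I_n -> {linear U -> V}) (c : 'rV[K]_n) x :
  row_comb b c x = row_comb (fun j => b j x) c.
Proof.
exact: (big_morph (fun f : {linear U -> V} => f x) (fun _ _ => erefl) erefl).
Qed.

End Operators.

(** * Reduction of the operator space to a pencil of matrices *)

Theorem theorem3p13 (K : fieldType) (U V : lmodType K) (n : nat)
    (S : submodClosed {linear U -> V})
    (dimS : has_dim [set f : {linear U -> V} | f \in S] n)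
    (S_LLD : LLD S 1)
    (cardK : ([set: 'I_n] #<= [set: K])%card)
    (S_not_2LLD : ~ LLD S 2) :
  (forall f : {linear U -> V}, f \in S -> rank_le f n.-1) \/
  (forall phi : {linear subspace S -> V},
     rank_optimal (dual_op_space S) phi ->
     forall f : subspace S, op_ker phi f -> rank_lt (subspace_val f) n.-1).
Proof.
have [z zI] : exists z : 'I_n -> K, injective z.
  have /card_leP[z] := cardK; exists (fun i => val (z (to_setT i))) => i j.
  move=> /val_inj zij; have := @inj _ _ _ z (to_setT i) (to_setT j).
  by rewrite !inE => /(_ I I zij)/(congr1 val).
have [|] := pselect (forall f, f \in S -> rank_le f n.-1); first by left.
move=> /existsNP[g /not_implyP[gS rk_g]]; right.
move=> _ [[x0 _ <-] [r rk_x0 opt]] f fx0; apply: contrapT => rk_f.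
have /existsNP[x1 ker_x1] := S_not_2LLD.
have [vf [vfP vfI]] := range_dim_lt_or_ge rk_f.
have /choice[yf yfE] k : exists y, subspace_val f y = vf k.
  by have [y _ <-] := vfP k; exists y.
have [vg [vgP vgI]] : dim_ge (range g) n.
  apply: range_dim_lt_or_ge => -[d gd dn]; apply: rk_g; exists d => //.
  by case: (n) dn.
have /choice[yg ygE] k : exists y, g y = vg k.
  by have [y _ <-] := vgP k; exists y.
have [b [bI bS]] := dimS.
have S_comb h : h \in S -> exists c, h = row_comb b c.
  move=> hS; have : [set h | h \in S] h by [].
  by rewrite bS => -[c _ <-]; exists (\row_i c i); rewrite lin_combE.
have comb_S c : row_comb b c \in S.
  by have : range (lin_comb b) (row_comb b c) by [exists (c 0)]; rewrite -bS.
(* Finitely many vectors carry all the rank information: two evaluation points, and preimages of n -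
   1 independent values of [f] and of n independent values of [g]. *)
pose s := x0 :: x1 :: codom yf ++ codom yg.
pose X := tnth (in_tuple s).
have memX x : x \in s -> exists i, x = X i by move=> /(@tnthP _ _ (in_tuple s)).
have [m [v [vI vs]]] := finite_coordinates [seq b j x | j <- enum 'I_n, x <- s].
have /choice[C CE] (ij : 'I_(size s) * 'I_n) :
    exists c, b ij.2 (X ij.1) = row_comb v c.
  apply/vs/allpairsP; exists (ij.2, X ij.1).
  by split; [rewrite mem_enum|exact: (mem_tnth ij.1 (in_tuple s))|].
(* Row j holds the coordinates of [b j (X i)]: this is the matrix of the dual operator at [X i]. *)
pose M i := \matrix_j C (i, j).
have combX c i : row_comb b c (X i) = row_comb v (c *m M i).
  rewrite row_comb_app -row_comb_mul; congr (row_comb _ c).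
  by apply/funext => j; rewrite rowK -CE.
have comb_pencil c a : row_comb b c (row_comb X a) = row_comb v (c *m pencil M a).
  rewrite mul_pencil -row_comb_mul linear_sum; apply: eq_bigr => i _.
  by rewrite linearZ /= rowK combX.
(* If M a were row-free, every operator of [S] vanishing at [row_comb X a] would be zero, against
   LLD. *)
have M_lt a : (\rank (pencil M a) < n)%N.
  rewrite ltn_neqAle rank_leq_row andbT; apply/negP => Mfree.
  have [h [hP hI]] := S_LLD (row_comb X a).
  have [/S_comb[c hc] h0] := hP 0.
  have c0 : c = 0.
    apply: (row_free_inj Mfree); rewrite mul0mx; apply: (row_comb_inj vI).
    by rewrite -comb_pencil -hc h0 linear0.
  have: lin_comb h (fun=> 1) = 0.
    by rewrite /lin_comb big_ord1 hc c0 linear0 scaler0.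
  by move=> /hI/(_ 0)/eqP; rewrite oner_eq0.
have range_dual i : range (@dual_op _ _ _ S (X i)) =
    range (fun c => row_comb v (c *m M i)).
  apply/seteqP; split=> [_ [h _ <-]|_ [c _ <-]].
    have [c hc] := S_comb _ (subspace_valP h).
    by exists c => //; rewrite /dual_op hc combX.
  by exists (Subspace (comb_S c)) => //; rewrite /dual_op combX.
have [i0 x0E] : exists i, x0 = X i by apply: memX; rewrite !inE eqxx.
have [i1 x1E] : exists i, x1 = X i by apply: memX; rewrite !inE eqxx orbT.
(* A smaller rank would leave two independent operators of [S] vanishing at [x1]. *)
have rk_i1 : (n.-1 <= \rank (M i1))%N.
  rewrite leqNgt; apply/negP => rk_lt; apply: ker_x1.
  have /mxrank_geP[P [Q PQ]] : (2 <= \rank (kermx (M i1)))%N.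
    by rewrite mxrank_ker ltn_subRL addn1 -ltn_predRL.
  exists (fun k => row_comb b (row k (P *m kermx (M i1)))); split.
    move=> k; split; first exact: comb_S.
    by rewrite x1E combX -row_mul -mulmxA mulmx_ker mulmx0 row0 linear0.
  by apply/(lin_indep_comp _ bI)/row_freeP; exists Q.
(* By rank-optimality, the rank at [x0] is at least that at [x1]. *)
have rk_i0 : (n.-1 <= \rank (M i0))%N.
  apply: (leq_trans rk_i1).
  have [d rk_x1 dr] := opt (dual_op x1) (ex_intro2 _ _ x1 I erefl).
  apply: (@leq_trans r).
    apply: leq_trans dr; apply/(has_dim_ge _ rk_x1).
    by rewrite x1E range_dual; apply/dim_ge_row_comb.
  apply/(dim_ge_row_comb _ _ vI); rewrite -range_dual -x0E.
  exact/(has_dim_ge _ rk_x0).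
have [cf fE] := S_comb _ (subspace_valP f).
have [cg gE] := S_comb _ gS.
have op_ge h c k (w : 'I_k -> V) (y : 'I_k -> U) : h = row_comb b c ->
    lin_indep w -> (forall j, h (y j) = w j) -> (forall j, y j \in s) ->
    (k <= \rank (pencil_op M c))%N.
  move=> hc wI hy ys; apply/(dim_ge_row_comb _ _ vI); exists w; split=> // j.
  have [i yE] := memX _ (ys j); exists (delta_mx 0 i) => //.
  by rewrite -rowE rowK -combX -hc -yE hy.
(* This contradicts the n independent values of [g] at points of [s]. *)
suff: (\rank (pencil_op M cg) < n)%N.
  rewrite ltnNge (op_ge _ _ _ _ _ gE vgI ygE) // => j.
  by rewrite !inE mem_cat codom_f !orbT.
apply: (rank_pencil_op_lt (a := delta_mx 0 i0) (f := cf) cg zI M_lt).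
- by rewrite pencil_delta.
- rewrite pencil_delta; apply: (row_comb_inj vI).
  by rewrite -combX -fE -x0E linear0; exact: fx0.
apply: (op_ge _ _ _ _ _ fE vfI yfE) => j.
by rewrite !inE mem_cat codom_f !orbT.
Qed.
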